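(* The class of locatable graphs is not hereditary: it is not closed under deleting vertices. Equivalently, there exist a locatable graph $G$ and an induced subgraph of $G$ that is not locatable.
   Context: The robber-locating game on a finite connected simple graph $G$: a robber occupies an unknown vertex. In each round the cop probes any vertex $p$ of $G$ (no restriction), and the robber truthfully announces the graph distance from his current vertex to $p$. If the information gathered so far determines the robber's current vertex uniquely, the cop wins. Otherwise the robber moves to an adjacent vertex or stays put, with the no-backtrack condition: he may not move to the vertex $p$ just probed. The robber is omniscient (knows the cop's strategy, including her future probes). $G$ is called locatable if the cop has a strategy guaranteed to determine the robber's vertex after finitely many probes, and non-locatable otherwise. *)

(* Defs.v *)
From mathcomp Require Import all_boot.

Set Implicit Arguments.
Unset Strict Implicit.
Unset Printing Implicit Defensive.

Record sgraph := SGraph {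
  vertex :> finType;
  adj : rel vertex;
  adj_sym : symmetric adj;
  adj_irr : irreflexive adj
}.

Section Graph.

Variable G : sgraph.
Implicit Types (x y p : G) (n : nat).

Definition connected : Prop := 0 < #|G| /\ forall x y, connect (@adj G) x y.

Definition walk n x y : bool :=
  [exists w : n.-tuple G, path (@adj G) x w && (last x w == y)].

(* The least n < #|G| such that there is a walk of length n from x to y; when
   y is not reachable from x the value is #|G|. *)
Definition dist x y : nat := find (fun n => walk n x y) (iota 0 #|G|).

(* A strategy maps the robber's answers so far, oldest first, to the next
   probe.  The earlier probes need not be recorded, since the strategy and the
   answers determine them. *)
Definition strategy := seq nat -> G.

(* In the plays below, r n is the robber's vertex when the probe number n is
   made (counting from 0). *)
Fixpoint answers (s : strategy) (r : nat -> G) n : seq nat :=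
  if n is m.+1 then
    rcons (answers s r m) (dist (r m) (s (answers s r m)))
  else [::].

Definition probe (s : strategy) (r : nat -> G) n : G := s (answers s r n).

Definition robber_move p x y : bool := ((y == x) || adj x y) && (y != p).

Definition legal (s : strategy) (r : nat -> G) n : Prop :=
  forall i, i < n -> robber_move (probe s r i) (r i) (r i.+1).

(* Every play that obeys the rules and agrees with r on the answers to the
   probes 0, ..., n has the robber on r n at the time of the probe n. *)
Definition located (s : strategy) (r : nat -> G) n : Prop :=
  forall r' : nat -> G,
    legal s r' n -> answers s r' n.+1 = answers s r n.+1 -> r' n = r n.

(* Quantifying over all plays r after the strategy is fixed accounts for the
   omniscience of the robber. *)
Definition locatable : Prop :=
  exists s : strategy, forall r : nat -> G,
    (forall n, legal s r n) -> exists n, located s r n.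

End Graph.

Section Induced.

Variables (G : sgraph) (A : {set G}).

Definition induced_adj : rel {x : G | x \in A} :=
  fun x y => adj (val x) (val y).

Lemma induced_adj_sym : symmetric induced_adj.
Proof. by move=> x y; apply: adj_sym. Qed.

Lemma induced_adj_irr : irreflexive induced_adj.
Proof. by move=> x; apply: adj_irr. Qed.

Definition induced : sgraph := SGraph induced_adj_sym induced_adj_irr.

End Induced.

(* Main.v *)
(** The graph G consists of the triangle 5-6-7, the four-cycles 6-0-8-1 and
    4-2-7-3, and the edge 4-5; deleting the vertex 8 yields H.  For the cop,
    what matters is the set of vertices on which the robber may be when a probe
    is made.  In G, a short adaptive strategy reduces this set to one vertex,
    whatever the answers.  In H, there is a finite family of vertex sets such
    that, from each of them and after each probe, some answer leaves at least
    two possible vertices, whose legal moves cover another set of the family.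
    This gives an infinite sequence of answers, each finite part of which
    belongs to a play, and Koenig's lemma turns it into an infinite play in
    which the robber is never located. *)

Require Import Defs.
From mathcomp Require Import all_boot boolp.

Set Implicit Arguments.
Unset Strict Implicit.
Unset Printing Implicit Defensive.

(** * Koenig's lemma for sequences over a finite type *)

Lemma konig (T : finType) (P : nat -> (nat -> T) -> Prop) :
    (forall m r r', (forall i, i <= m -> r i = r' i) -> P m r -> P m r') ->
    (forall m r, P m.+1 r -> P m r) ->
    (forall m, exists r, P m r) ->
  exists r, forall m, P m r.
Proof.
move=> Peq Pdown Pex.
have Ple k m r : k <= m -> P m r -> P k r.
  by move=> /subnK <-; elim: (m - k) => // i IHi /Pdown.
have [r0 _] := Pex 0; pose x0 := r0 0.
pose prefix (w : seq T) r := forall i, i < size w -> r i = nth x0 w i.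
pose extendible w := forall m, exists2 r, P m r & prefix w r.
(* By finiteness of [T]: if every letter [x] failed at some level [b x], a sequence with prefix [w]
   satisfying [P] at the maximal such level would, by [Ple], contradict the bound of its own next
   letter. *)
have step w : exists x, extendible w -> extendible (rcons w x).
  apply: contrapT => /forallNP noext.
  have /choice[b bP] x : exists m, forall r, P m r -> ~ prefix (rcons w x) r.
    have /not_implyP[_ /existsNP[m nPm]] := noext x; exists m => r Pr wr.
    by apply: nPm; exists r.
  have /not_implyP[wext _] := noext x0.
  have [r Pr wr] := wext (\max_x b x); pose x := r (size w).
  apply: (bP x r); first by apply: Ple Pr; apply: leq_bigmax.
  move=> i; rewrite size_rcons ltnS nth_rcons leq_eqVlt.
  by case/predU1P=> [-> | lti]; rewrite ?ltnn ?eqxx // lti wr.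
have {step}[g gP] := choice step.
pose w := fix w m := if m is k.+1 then rcons (w k) (g (w k)) else [::].
have w_ext m : extendible (w m).
  elim: m => [|m IHm] /=; last exact: gP.
  by move=> k; have [r Pr] := Pex k; exists r.
have size_w m : size (w m) = m.
  by elim: m => //= m IHm; rewrite size_rcons IHm.
have nth_w m i : i < m -> nth x0 (w m) i = g (w i).
  elim: m => // m IHm; rewrite ltnS leq_eqVlt /= nth_rcons size_w.
  by case/predU1P=> [-> | lti]; rewrite ?ltnn ?eqxx // lti IHm.
exists (fun i => g (w i)) => m; have [r Pr wr] := w_ext m.+1 m.
by apply: Peq Pr => i lei; rewrite wr ?size_w // nth_w.
Qed.

Lemma constant_eq (T : eqType) (w : seq T) x y :
  constant w -> x \in w -> y \in w -> x = y.
Proof. by case/(constantP x)=> z -> /nseqP[-> _] /nseqP[-> _]. Qed.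

(** * Plays up to a given time *)

Section Plays.

Variables (G : sgraph) (s : strategy G).
Implicit Types r : nat -> G.

Lemma answers_eq r r' n :
  (forall i, i < n -> r i = r' i) -> answers s r n = answers s r' n.
Proof.
elim: n => //= n IHn eqr; rewrite eqr // IHn // => i lti.
by rewrite eqr // ltnW.
Qed.

Lemma legal_eq r r' n :
  (forall i, i <= n -> r i = r' i) -> legal s r n -> legal s r' n.
Proof.
move=> eqr leg i lti; have lei := ltnW lti.
have := leg i lti; rewrite /probe (@answers_eq r r'); last first.
  by move=> j ltj; rewrite eqr // ltnW // (ltn_trans ltj).
by rewrite !eqr.
Qed.

Lemma legalS r n :
  legal s r n.+1 <->
  legal s r n /\ robber_move (probe s r n) (r n) (r n.+1).
Proof.
split=> [leg | [leg mv] i].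
  by split=> [i lti|]; apply: leg => //; apply: ltnW.
by rewrite ltnS leq_eqVlt => /predU1P[-> | /leg].
Qed.

End Plays.

(* Statements about a graph are decided by computation on numbers: [f] labels
   the vertices with 0, ..., n - 1, [e] is the adjacency of labels and [d] the
   purported distance. *)
Section Labelled.

Variables (n : nat) (e : rel nat) (d : nat -> nat -> nat).

(** Such a [d] is the graph distance: the bound along edges makes every walk long enough, and the
    neighbour one step closer yields a geodesic. [d i k < n] keeps the values in the range searched
    by [dist]. *)
Definition is_metric : bool :=
  all (fun k => all (fun i =>
    [&& d i k < n, (d i k == 0) == (i == k),
        all (fun j => e i j ==> (d i k <= (d j k).+1)) (iota 0 n)
      & (i == k) || has (fun j => e i j && (d i k == (d j k).+1)) (iota 0 n)])
  (iota 0 n)) (iota 0 n).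

Definition moves p (C : seq nat) : seq nat :=
  [seq y <- iota 0 n | (y != p) &&
    has (fun x => (x \in C) && ((y == x) || e x y)) (iota 0 n)].

Definition cell p q (C : seq nat) : seq nat :=
  [seq x <- iota 0 n | (x \in C) && (d x p == q)].

(* [h] lists the answers so far, and [C] the labels of the vertices on which
   the robber may be, at the time of the next probe [s h].  The conditional
   stands for a disjunction, both sides of which [vm_compute] would evaluate. *)
Fixpoint cop_wins (s : seq nat -> nat) k (h C : seq nat) : bool :=
  if k is k'.+1 then
    all (fun q => let T := cell (s h) q C in
      if constant T then true else cop_wins s k' (rcons h q) (moves (s h) T))
    (iota 0 n)
  else false.

(** Inclusion in the moves, not equality: giving up options only hurts the robber, and this keeps
    the family small. *)
Definition escape (F : seq (seq nat)) p C q S : bool :=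
  [&& ~~ constant (cell p q C), S \in F
    & all (mem (moves p (cell p q C))) S].

Definition robber_wins (F : seq (seq nat)) : bool :=
  all (fun C => all (fun p =>
    has (fun q => has (escape F p C q) F) (iota 0 n)) (iota 0 n)) F.

Variables (G : sgraph) (f : G -> nat).
Hypothesis f_inj : injective f.
Hypothesis f_image : forall i, reflect (exists x, f x = i) (i < n).
Hypothesis f_adj : forall x y, adj x y = e (f x) (f y).
Hypothesis d_metric : is_metric.

Lemma f_iota x : f x \in iota 0 n.
Proof. by rewrite mem_iota; apply/f_image; exists x. Qed.

Lemma card_labelled : #|G| = n.
Proof.
rewrite cardE -(size_map f) -[RHS](size_iota 0); apply/perm_size/uniq_perm.
- by rewrite map_inj_uniq // enum_uniq.
- exact: iota_uniq.
move=> i; rewrite mem_iota add0n /=; apply/mapP/f_image => [[x _ ->]|[x <-]].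
  by exists x.
by exists x => //; rewrite mem_enum.
Qed.

Lemma metricP x y :
  [/\ d (f x) (f y) < n, (d (f x) (f y) == 0) = (x == y),
      forall z, adj x z -> d (f x) (f y) <= (d (f z) (f y)).+1
    & x != y -> exists2 z, adj x z & d (f x) (f y) = (d (f z) (f y)).+1].
Proof.
have /allP/(_ _ (f_iota x)) := allP d_metric _ (f_iota y).
rewrite inj_eq // => /and4P[ltd /eqP d0 /allP dle dlt]; split=> //.
  by move=> z; rewrite f_adj; apply/implyP/dle/f_iota.
move/negPf=> nxy; move: dlt; rewrite nxy /= => /hasP[j].
rewrite mem_iota /= => /f_image[z <-]; rewrite -f_adj => /andP[xz /eqP ->].
by exists z.
Qed.

Lemma walk_geodesic x y : walk (d (f x) (f y)) x y.
Proof.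
have [m] := ubnP (d (f x) (f y)); elim: m x => // m IHm x.
rewrite ltnS; have [_ dxy _ geo] := metricP x y; move: dxy.
case: eqVneq geo => [-> _ /eqP -> _ | _ /(_ isT)[z xz ->] _ lt_m].
  by apply/existsP; exists [tuple]; rewrite /= eqxx.
have /existsP[w /andP[zw wy]] := IHm z lt_m.
by apply/existsP; exists [tuple of z :: w]; rewrite /= xz zw.
Qed.

Lemma dist_le_walk m x y : walk m x y -> d (f x) (f y) <= m.
Proof.
case/existsP=> -[w /= /eqP <-]; elim: w x => [|z w IHw] x /=.
  by have [_ dxy _ _] := metricP x y; rewrite -dxy leqn0.
case/andP=> /andP[xz zw] wy; have [_ _ le_d _] := metricP x y.
by apply: leq_trans (le_d z xz) _; rewrite ltnS IHw // zw.
Qed.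

Lemma dist_labelled x y : dist x y = d (f x) (f y).
Proof.
have [lt_n _ _ _] := metricP x y; rewrite /dist card_labelled.
set a := fun m => walk m x y.
have has_a : has a (iota 0 n).
  apply/hasP; exists (d (f x) (f y)); first by rewrite mem_iota.
  exact: walk_geodesic.
apply/eqP; rewrite eqn_leq; apply/andP; split.
  rewrite leqNgt; apply/negP=> /(before_find 0).
  by rewrite nth_iota // /a walk_geodesic.
apply: dist_le_walk; have := nth_find 0 has_a.
by rewrite nth_iota // -[X in _ < X](size_iota 0) -has_find.
Qed.

Lemma connected_labelled : 0 < n -> connected G.
Proof.
rewrite -card_labelled => G_gt0; split=> // x y.
have /existsP[w /andP[xw /eqP wy]] := walk_geodesic x y.
by apply/connectP; exists w.
Qed.

Lemma mem_moves p C x y :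
  f x \in C -> robber_move p x y -> f y \in moves (f p) C.
Proof.
move=> Cx /andP[mv nyp]; rewrite mem_filter f_iota inj_eq // nyp andbT /=.
by apply/hasP; exists (f x); rewrite ?f_iota // Cx -f_adj inj_eq.
Qed.

Lemma movesP p T i : i \in moves (f p) T ->
  exists2 y, f y = i & exists2 x, f x \in T & robber_move p x y.
Proof.
rewrite mem_filter mem_iota /= => /andP[/andP[nip /hasP[j]]].
rewrite mem_iota /= => /f_image[x <-] /andP[Tx mv] /f_image[y yi].
exists y => //; exists x => //.
by rewrite /robber_move -(inj_eq f_inj) f_adj yi mv -(inj_eq f_inj) yi.
Qed.

Lemma mem_cell p q C x : (f x \in cell p q C) = (f x \in C) && (d (f x) p == q).
Proof. by rewrite mem_filter f_iota andbT. Qed.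

(** Induction on the remaining probes: [C] keeps containing the label of every vertex consistent
    with the answers, so a constant cell pins the robber down. [constant] also accepts empty cells,
    the answers that no play gives. *)
Lemma cop_wins_located (s : strategy G) s0 k h C :
    (forall h, f (s h) = s0 h) -> cop_wins s0 k h C ->
  forall r m, (forall i, legal s r i) -> answers s r m = h ->
    (forall r', legal s r' m -> answers s r' m = h -> f (r' m) \in C) ->
  exists i, located s r i.
Proof.
move=> sE; elim: k h C => //= k IHk h C /allP.
rewrite -sE => win r m leg ans candC.
pose q := d (f (r m)) (f (s h)).
have q_iota : q \in iota 0 n by rewrite mem_iota; case: (metricP (r m) (s h)).
set T := cell (f (s h)) q C.
have candT r' : legal s r' m -> answers s r' m.+1 = rcons h q -> f (r' m) \in T.
  move=> leg' /= /rcons_inj[ans']; rewrite ans' dist_labelled => dq.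
  by rewrite mem_cell dq eqxx candC.
have ansS : answers s r m.+1 = rcons h q by rewrite /= ans dist_labelled.
move: (win q q_iota) => /=; rewrite -/T; case: ifP => [constT _ | _ wink].
  exists m => r' leg' ans'; apply: f_inj; apply: (constant_eq constT).
    by apply: candT => //; rewrite ans' ansS.
  exact: candT.
apply: (IHk _ _ wink r m.+1) => // r' /legalS[leg' mv] ans'.
have /= /rcons_inj[ans'm _] := ans'.
by move: mv; rewrite /probe ans'm; apply: mem_moves; apply: candT.
Qed.

(** The replies fix one infinite answer sequence [h]. Each vertex of [C m] ends a legal play with
    these answers, but the plays for different [m] need not extend each other, hence [konig]. The
    limit play is never located, as [T m] always offers another vertex. *)
Lemma robber_wins_nonlocatable F :
  F != [::] -> robber_wins F -> ~ locatable G.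
Proof.
case: F => // C0 F0 _; set F := C0 :: F0 => /allP win [s s_wins].
have /choice[reply replyP] (hC : seq nat * seq nat) : exists qS, hC.2 \in F ->
    escape F (f (s hC.1)) hC.2 qS.1 qS.2.
  (* [choice] needs a value off [F] too; [(0, [::])] is arbitrary. *)
  have [CF | CnF] := boolP (hC.2 \in F); last by exists (0, [::]).
  have /allP/(_ _ (f_iota (s hC.1)))/hasP[q _ /hasP[S _ esc]] := win _ CF.
  by exists (q, S).
pose next hC : seq nat * seq nat := (rcons hC.1 (reply hC).1, (reply hC).2).
(* Any member of [F] can serve as start, the robber's first vertex being free. *)
pose state m := iter m next ([::], C0).
pose h m := (state m).1; pose C m := (state m).2.
pose q m := (reply (state m)).1.
pose T m := cell (f (s (h m))) (q m) (C m).
have CF m : C m \in F.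
  by elim: m => [|m /replyP/and3P[]//]; apply: mem_head.
have T_nonconst m : ~~ constant (T m) by have /and3P[] := replyP _ (CF m).
have T_moves m : {subset C m.+1 <= moves (f (s (h m))) (T m)}.
  by have /and3P[_ _ /allP] := replyP _ (CF m).
have play_C m x : f x \in C m ->
    exists r, [/\ legal s r m, answers s r m = h m & r m = x].
  elim: m x => [|m IHm] y; first by exists (fun _ => y).
  move/T_moves/movesP=> [z /f_inj-> [x]].
  rewrite mem_cell => /andP[Cx /eqP dq] mv.
  have [r [leg ans rm]] := IHm x Cx.
  pose r' i := if i <= m then r i else y.
  have eqr i : i <= m -> r i = r' i by rewrite /r' => ->.
  have ans' : answers s r' m = h m.
    by rewrite -ans; apply: answers_eq => i lti; rewrite eqr // ltnW.
  have r'm : r' m = x by rewrite -eqr.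
  have r'S : r' m.+1 = y by rewrite /r' ltnn.
  exists r'; split=> //; last by rewrite /= ans' r'm dist_labelled dq.
  apply/legalS; split; first exact: legal_eq leg.
  by rewrite /probe ans' r'm r'S.
have play_T m i : i \in T m ->
    exists r, [/\ legal s r m, answers s r m.+1 = h m.+1 & f (r m) = i].
  rewrite mem_filter mem_iota /= andbC.
  case/andP=> /f_image[x <-] /andP[Cx /eqP dq].
  have [r [leg ans rm]] := play_C m x Cx.
  exists r; split=> //; last by rewrite rm.
  by rewrite /= ans rm dist_labelled dq.
have T_other m i : exists2 j, j \in T m & j != i.
  by apply/hasP; apply: contraNT (T_nonconst m) => /hasPn noj;
    apply: (@all_pred1_constant _ i); apply/allP=> j /noj; rewrite negbK.
have [||m|r rP] := @konig G (fun m r => legal s r m /\ answers s r m = h m).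
- move=> m r r' eqr [leg ans]; split; first exact: legal_eq leg.
  by rewrite -ans; apply/esym/answers_eq => i lti; rewrite eqr // ltnW.
- by move=> m r [/legalS[leg _]] /= /rcons_inj[ans _].
- have [i /play_T[r [leg /rcons_inj[ans _] _]] _] := T_other m 0.
  by exists r.
have [|m loc] := s_wins r; first by move=> m; have [] := rP m.
have [i /play_T[r' [leg ans ri]] /eqP[]] := T_other m (f (r m)).
by rewrite -ri (loc r') // ans; have [_ ->] := rP m.+1.
Qed.

End Labelled.

(** * The nine-vertex graph and its subgraph *)

Definition edges : seq (nat * nat) :=
  [:: (4, 2); (4, 3); (5, 4); (6, 0); (6, 1); (6, 5);
      (7, 2); (7, 3); (7, 5); (7, 6); (8, 0); (8, 1)].

Definition edge : rel nat :=
  fun i j => ((i, j) \in edges) || ((j, i) \in edges).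

(** One table serves both graphs: deleting 8 changes no other distance, as its only neighbours 0 and
    1 have the common neighbour 6. *)
Definition distance (i j : nat) : nat :=
  nth 0 (nth [::]
    [:: [:: 0; 2; 3; 3; 3; 2; 1; 2; 1];
        [:: 2; 0; 3; 3; 3; 2; 1; 2; 1];
        [:: 3; 3; 0; 2; 1; 2; 2; 1; 4];
        [:: 3; 3; 2; 0; 1; 2; 2; 1; 4];
        [:: 3; 3; 1; 1; 0; 1; 2; 2; 4];
        [:: 2; 2; 2; 2; 1; 0; 1; 1; 3];
        [:: 1; 1; 2; 2; 2; 1; 0; 1; 2];
        [:: 2; 2; 1; 1; 2; 1; 1; 0; 3];
        [:: 1; 1; 4; 4; 4; 3; 2; 3; 0]] i) j.

(** The probe at 8 separates 0, 1 from 5, 7, which the probe at 6 does not. *)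
Definition cop_probe (h : seq nat) : nat :=
  match h with
  | [::] => 6
  | [:: _] => 4
  | [:: _; a] => if a == 3 then 6 else 5
  | [:: _; a; b] => if a == 3 then 0 else if b == 2 then 4 else 8
  | [:: _; _; b; c] => if b == 2 then 2 else if c == 1 then 0 else 4
  | _ => 2
  end.

Lemma cop_probe_lt h : cop_probe h < 9.
Proof.
by case: h => [|? [|a [|b [|c [|? ?]]]]] //; rewrite /cop_probe; do ?case: ifP.
Qed.

Definition hideout : seq (seq nat) :=
  [:: [:: 3; 4; 5; 6]; [:: 0; 1; 4; 6; 7]; [:: 0; 1; 2; 3; 6; 7];
      [:: 3; 4; 5; 7]; [:: 0; 2; 3; 5; 7]; [:: 2; 5; 6; 7];
      [:: 2; 4; 5; 6]; [:: 3; 5; 6; 7]; [:: 2; 4; 6; 7]].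

Lemma ord_edge_sym : symmetric (fun i j : 'I_9 => edge i j).
Proof. by move=> i j; apply: orbC. Qed.

Lemma ord_edge_irr : irreflexive (fun i j : 'I_9 => edge i j).
Proof.
move=> i; rewrite /edge orbb; apply/negP.
by move/(allP (isT : all (fun z => z.1 != z.2) edges)); rewrite eqxx.
Qed.

Definition graph9 : sgraph := SGraph ord_edge_sym ord_edge_irr.

Definition old_vertices : {set graph9} := [set i : 'I_9 | i < 8].

Lemma graph9_image i : reflect (exists x : graph9, val x = i) (i < 9).
Proof.
by apply: (iffP idP) => [lti | [x <-]]; [exists (Ordinal lti) | exact: ltn_ord].
Qed.

Lemma induced_image i :
  reflect (exists x : induced old_vertices, val (val x) = i) (i < 8).
Proof.
apply: (iffP idP) => [lti | [x <-]]; last by have := valP x; rewrite inE.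
have lti9 : i < 9 by apply: ltnW.
have ini : (Ordinal lti9 : graph9) \in old_vertices by rewrite inE.
by exists (exist (fun x : graph9 => x \in old_vertices) _ ini).
Qed.

Theorem theorem2p1 :
  exists (G : sgraph) (A : {set G}),
    connected G /\ connected (induced A) /\
    locatable G /\ ~ locatable (induced A).
Proof.
have metric9 : is_metric 9 edge distance by vm_compute.
have metric8 : is_metric 8 edge distance by vm_compute.
have f9_inj : injective (fun x : graph9 => val x) by apply: val_inj.
have f8_inj : injective (fun x : induced old_vertices => val (val x)).
  exact: inj_comp val_inj val_inj.
have adj9 (x y : graph9) : adj x y = edge (val x) (val y) by [].
have adj8 (x y : induced old_vertices) :
  adj x y = edge (val (val x)) (val (val y)) by [].
exists graph9, old_vertices; split; [|split; [|split]].
- exact: (connected_labelled f9_inj graph9_image adj9 metric9 isT).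
- exact: (connected_labelled f8_inj induced_image adj8 metric8 isT).
- pose s (h : seq nat) : graph9 := inord (cop_probe h).
  have sE h : val (s h) = cop_probe h by apply/inordK/cop_probe_lt.
  (* Six probes suffice from the full vertex set; the sixth falls in the default case of
     [cop_probe]. *)
  have win : cop_wins 9 edge distance cop_probe 6 [::] (iota 0 9) by vm_compute.
  exists s => r leg.
  have := cop_wins_located f9_inj graph9_image adj9 metric9 sE win leg.
  move=> /(_ 0 erefl); apply.
  by move=> r' _ _; apply: (f_iota graph9_image).
- have win : robber_wins 8 edge distance hideout by vm_compute.
  exact: (robber_wins_nonlocatable f8_inj induced_image adj8 metric8 _ win).
Qed.
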